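(* For every integer $n \geq 1$, \[ B(n) = (-1)^{n+1} + 2 \sum_{k=0}^{\lfloor n/2\rfloor} (2k)!\, S(n,2k) = (-1)^n + 2 \sum_{k=0}^{\lfloor n/2\rfloor} (2k+1)!\, S(n,2k+1), \] and \[ B(n) = \sum_{k=1}^{\lfloor (n+1)/2\rfloor} (2k-1)!\, S(n+1,2k) = \sum_{k=0}^{\lfloor (n+1)/2\rfloor} (2k)!\, S(n+1,2k+1). \]
   Context: For integers $n,k \geq 0$, $S(n,k)$ denotes the Stirling number of the second kind, i.e., the number of partitions of an $n$-element set into $k$ nonempty blocks (with $S(0,0)=1$, $S(n,0)=0$ for $n\geq 1$, and $S(n,k)=0$ for $k>n$). $B(n)$ denotes the $n$-th ordered Bell (Fubini) number, $B(n)=\sum_{k=0}^{n} k!\, S(n,k)$, equivalently given by the exponential generating function $\sum_{n\ge 0} B(n) x^n/n! = 1/(2-e^x)$. *)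

(* Defs.v *)
From mathcomp Require Import all_boot all_order all_algebra.

Set Implicit Arguments.
Unset Strict Implicit.
Unset Printing Implicit Defensive.

(* The number of partitions of an n-element set into k blocks; MathComp's
   [partition] already requires the blocks to be nonempty. *)
Definition stirling2 (n k : nat) : nat :=
  #|[set P : {set {set 'I_n}} | partition P [set: 'I_n] & #|P| == k]|.

Definition ordered_bell (n : nat) : nat :=
  \sum_(0 <= k < n.+1) k`! * stirling2 n k.

(* Main.v *)
Require Import Defs.
From mathcomp Require Import all_boot all_order all_algebra ring zify.

(* Put a_k = k! S(n,k).  The recurrence S(n+1,k+1) = (k+1) S(n,k+1) + S(n,k)
   gives k! S(n+1,k+1) = a_(k+1) + a_k; summing over the k of a fixed parity
   yields the second pair of formulas, as a_0 = 0 for n >= 1.  It also gives, by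
   a telescoping sum, \sum_k (-1)^k a_k = (-1)^n; combined with
   B(n) = \sum_k a_k this isolates the even and the odd terms. *)

Set Implicit Arguments.
Unset Strict Implicit.
Unset Printing Implicit Defensive.

(** With an arbitrary [D] in place of the full set of ['I_n], a point can be removed from the ground
    set without changing its type. *)
Definition set_parts (T : finType) (D : {set T}) (k : nat) :=
  [set P : {set {set T}} | partition P D & #|P| == k].

(** For [C] empty nothing is removed on either side, since no block is empty. This treats both kinds
    of remainder [C] uniformly. *)
Lemma partition_setD1 (T : finType) (D : {set T}) (P : {set {set T}}) C :
  partition P D -> C \in set0 |: P -> partition (P :\ C) (D :\: C).
Proof.
move=> PD; rewrite !inE; case: eqVneq => [-> _ | _ /= CP]; last exact: partitionD1.
rewrite setD0; suff -> : P :\ set0 = P by [].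
by apply/setDidPl; rewrite disjoint_sym disjoints1 (partition0 PD).
Qed.

(* A partition of [x |: D] amounts to a partition [P] of [D] together with the
   remainder [C] of the block of [x], which is either a block of [P] or empty. *)
Lemma card_set_partsU1_pairs (T : finType) (D : {set T}) x k : x \notin D ->
  #|set_parts (x |: D) k.+1| =
  #|[set p : {set {set T}} * {set T} |
      partition p.1 D && ((p.2 \in set0 |: p.1) && (#|p.1 :\ p.2| == k))]|.
Proof.
move=> xD; set X := [set p | _].
have X_sub p : p \in X -> p.2 \subset D.
  rewrite inE => /and3P[pD]; rewrite !inE => /orP[/eqP-> _|p2 _].
    exact: sub0set.
  exact: partitionS pD p2.
have X_notin p (B : {set T}) : p \in X -> x \in B -> B \notin p.1 :\ p.2.
  rewrite inE => /and3P[pD p2 _] xB; apply: contraNN xD.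
  move/(partitionS (partition_setD1 pD p2))/subsetP/(_ x xB).
  by rewrite inE => /andP[].
(* [f] puts [x] into the block [C]; an empty [C] yields the new block [[set x]]. *)
pose f (p : {set {set T}} * {set T}) := (x |: p.2) |: (p.1 :\ p.2).
have X_part p : p \in X -> partition (f p) (x |: D).
  move=> pX; have sC := X_sub p pX; move: (pX); rewrite inE => /and3P[pD p2 _].
  have -> : x |: D = (x |: p.2) :|: (D :\: p.2).
    by rewrite -setUA setDE setUIr setUCr setIT (setUidPr sC).
  apply: partitionU1; first exact: partition_setD1.
    by apply/set0Pn; exists x; rewrite setU11.
  rewrite -setI_eq0; apply/eqP/setP=> y; rewrite !inE.
  by case: eqVneq => [->|_] /=; [rewrite (negPf xD) andbF | case: (y \in p.2)].
have notin_sub p : p \in X -> x \notin p.2.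
  by move=> pX; apply: contraNN xD => /(subsetP (X_sub p pX)).
have f_inj : {in X &, injective f}.
  move=> p q pX qX fpq.
  (* Injectivity: the block of [x] in [f r] determines the remainder [r.2]. *)
  have blockE r : r \in X -> pblock (f r) x = x |: r.2.
    move=> rX; apply: def_pblock; [|exact: setU11|exact: setU11].
    exact: partition_trivIset (X_part r rX).
  have E2 : p.2 = q.2.
    have := blockE p pX; rewrite fpq blockE // => /(congr1 (fun A => A :\ x)).
    by rewrite !setU1K ?notin_sub.
  have E1 : p.1 :\ p.2 = q.1 :\ p.2.
    move/(congr1 (fun A => A :\ (x |: p.2))): fpq.
    rewrite /f -E2 !setU1K ?X_notin ?setU11 //.
    by rewrite [in X in _ :\ X]E2 X_notin ?setU11.
  suff : p.1 = q.1 by case: p q E2 {E1 fpq pX qX} => [a b] [c d] /= -> ->.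
  move: pX qX; rewrite !inE -E2 => /and3P[pD p2 _] /and3P[qD q2 _].
  (* An empty remainder is a block of neither partition, so its removal loses nothing; a nonempty
     one is a block of both and can be put back. *)
  case: (eqVneq p.2 set0) p2 q2 E1 => [-> _ _|_ /= p2 q2 E1].
    move=> E; apply/setP=> A; move/setP/(_ A): E; rewrite !inE.
    case: eqVneq => //= -> _.
    by rewrite (partition0 pD) (partition0 qD).
  by rewrite -(setD1K p2) E1 setD1K.
rewrite -(card_in_imset f_inj); congr #|pred_of_set _|.
apply/setP=> P; apply/idP/imsetP=> [|[p pX ->]]; last first.
  rewrite inE X_part // cardsU1 X_notin ?setU11 //=.
  by move: pX; rewrite inE => /and3P[_ _ /eqP->].
rewrite inE => /andP[PD cP].
have xP : x \in cover P by rewrite (cover_partition PD) setU11.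
(* Surjectivity: the preimage of [P] is found by deleting [x] from its block. *)
pose B := pblock P x; pose C := B :\ x.
have BP : B \in P by apply: pblock_mem.
have xB : x \in B by rewrite mem_pblock.
have BE : x |: C = B by rewrite setD1K.
have sC : C \subset D.
  have := setSD [set x] (partitionS PD BP); rewrite -/C.
  by rewrite setU1K.
have PBD : partition (P :\ B) (D :\: C).
  have := partitionD1 PD BP; suff -> : (x |: D) :\: B = D :\: C by [].
  apply/setP=> y; rewrite -BE in_setD in_setU1 (in_setU1 y x D) in_setD.
  by case: eqVneq => [->|] //=; rewrite (negPf xD) andbF.
(* Such a block would be nonempty, yet contained in [D :\: C]. Hence adding [C] to [P :\ B] and
   removing it again gives back [P :\ B]. *)
have CPB : C \notin P :\ B.
  apply/negP=> CP.
  have /subsetP sCD := partitionS PBD CP.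
  case/set0Pn: (partition_neq0 PBD CP) => y yC.
  by move: (sCD y yC); rewrite inE yC.
have cPB : #|P :\ B| = k.
  by move: cP; rewrite (cardsD1 B) BP => /eqP[].
pose Q := if C == set0 then P :\ B else C |: (P :\ B).
have QC : Q :\ C = P :\ B.
  rewrite /Q; case: ifP => _; last by rewrite setU1K.
  by apply/setDidPl; rewrite disjoint_sym disjoints1.
exists (Q, C); last by rewrite /f /= QC BE setD1K.
rewrite inE /= QC cPB eqxx andbT; apply/andP; split; last first.
  by rewrite !inE /Q; case: eqP => //= _; rewrite setU11.
rewrite /Q; case: eqVneq => [C0|C0]; first by move: PBD; rewrite C0 setD0.
have -> : D = C :|: (D :\: C).
  by rewrite setDE setUIr setUCr setIT (setUidPr sC).
apply: partitionU1 => //; rewrite -setI_eq0; apply/eqP/setP=> y.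
by rewrite in_setI in_setD in_set0; case: (y \in C).
Qed.

(** Count the pairs for each fixed [P]: the empty [C] is admissible exactly when [P] has [k] blocks,
    and each of the blocks of [P] is admissible exactly when there are [k.+1] of them. *)
Lemma card_set_partsU1 (T : finType) (D : {set T}) x k : x \notin D ->
  #|set_parts (x |: D) k.+1| =
  k.+1 * #|set_parts D k.+1| + #|set_parts D k|.
Proof.
move=> xD; rewrite card_set_partsU1_pairs // -sum1dep_card.
rewrite -(pair_big_dep (fun P => partition P D)
  (fun P C => (C \in set0 |: P) && (#|P :\ C| == k)) (fun _ _ => 1)) /=.
rewrite -[#|set_parts D k.+1|]sum1_card -[#|set_parts D k|]sum1_card.
rewrite big_distrr /= [X in _ = X + _](eq_bigl
  (fun P => partition P D && (#|P| == k.+1))); last by move=> P; rewrite inE.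
rewrite [X in _ = _ + X](eq_bigl
  (fun P => partition P D && (#|P| == k))); last by move=> P; rewrite inE.
rewrite !(big_mkcondr _ _ (partition^~ D)) /= -big_split /=; apply: eq_bigr => P PD.
have P0 := partition0 PD.
rewrite big_mkcondr /= big_setU1 ?P0 //= addnC; congr (_ + _).
  rewrite (eq_bigr (fun=> (#|P| == k.+1) : nat)) => [|C CP]; last first.
    by rewrite [#|P|](cardsD1 C) CP eqSS; case: eqP.
  by rewrite sum_nat_const; case: eqP => [->|_]; rewrite ?muln0.
suff -> : P :\ set0 = P by [].
by apply/setDidPl; rewrite disjoint_sym disjoints1 P0.
Qed.

Lemma card_set_parts_set0 (T : finType) k : #|set_parts (set0 : {set T}) k| = (k == 0).
Proof.
case: k => [|k].
  have -> : set_parts (set0 : {set T}) 0 = [set set0]; last by rewrite cards1.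
  apply/setP=> P; rewrite !inE partition_set0 cards_eq0.
  by rewrite andbb.
apply/eqP; rewrite cards_eq0; apply/eqP/setP=> P; rewrite !inE partition_set0.
by case: eqP => // ->; rewrite cards0.
Qed.

Lemma card_set_parts0 (T : finType) (D : {set T}) :
  #|set_parts D 0| = (#|D| == 0).
Proof.
have [->|[x xD]] := set_0Vmem D; first by rewrite card_set_parts_set0 cards0.
rewrite (cardsD1 x) xD; apply/eqP; rewrite cards_eq0; apply/eqP/setP=> P.
rewrite !inE cards_eq0; apply/negP=> /andP[/cover_partition + /eqP P0].
by rewrite P0 /cover big_set0 => D0; rewrite -D0 inE in xD.
Qed.

(** Induction on the common size: removing a point from each set leads to the same recurrence on
    both sides. This carries the recurrence over to [stirling2]. *)
Lemma eq_card_set_parts (T U : finType) (D : {set T}) (E : {set U}) k :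
  #|D| = #|E| -> #|set_parts D k| = #|set_parts E k|.
Proof.
move Dn: #|D| => n; elim: n D E k Dn => [|n IH] D E k Dn.
  move/esym/eqP; rewrite cards_eq0 => /eqP->.
  by move/eqP: Dn; rewrite cards_eq0 => /eqP->; rewrite !card_set_parts_set0.
move=> En; case: k => [|k]; first by rewrite !card_set_parts0 Dn -En.
have [D0|[x xD]] := set_0Vmem D; first by rewrite D0 cards0 in Dn.
have [E0|[y yE]] := set_0Vmem E; first by rewrite E0 cards0 in En.
rewrite -(setD1K xD) -(setD1K yE) !card_set_partsU1 ?setD11 //.
have Dn' : #|D :\ x| = n by move: Dn; rewrite (cardsD1 x) xD => -[].
have En' : n = #|E :\ y| by move: En; rewrite (cardsD1 y) yE => -[].
by rewrite !(IH _ (E :\ y)).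
Qed.

Lemma stirling2_0 k : stirling2 0 k = (k == 0).
Proof.
rewrite -(card_set_parts_set0 (ordinal 0) k); apply: eq_card_set_parts.
by rewrite cardsT card_ord cards0.
Qed.

Lemma stirling2S0 n : stirling2 n.+1 0 = 0.
Proof. by rewrite [LHS](card_set_parts0 [set: 'I_n.+1]) cardsT card_ord. Qed.

Lemma stirling2SS n k :
  stirling2 n.+1 k.+1 = k.+1 * stirling2 n k.+1 + stirling2 n k.
Proof.
have cD : #|[set: 'I_n.+1] :\ ord0| = #|[set: 'I_n]|.
  by have := cardsD1 ord0 [set: 'I_n.+1]; rewrite !cardsT inE !card_ord => -[].
rewrite {1}/stirling2 -/(set_parts [set: 'I_n.+1] _) -(setD1K (in_setT (@ord0 n))).
by rewrite card_set_partsU1 ?setD11 // !(eq_card_set_parts _ cD).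
Qed.

Lemma stirling2_small n k : n < k -> stirling2 n k = 0.
Proof.
elim: n k => [|n IH] [|k] //; first by rewrite stirling2_0.
by rewrite ltnS => nk; rewrite stirling2SS !IH ?muln0 // ltnW.
Qed.

Lemma fact_stirling2SS n k :
  k`! * stirling2 n.+1 k.+1 = k.+1`! * stirling2 n k.+1 + k`! * stirling2 n k.
Proof. by rewrite stirling2SS mulnDr mulnA factS [k`! * _]mulnC. Qed.

(** The added terms vanish, so the bound can be given whichever parity a pairing of the terms
    needs. *)
Lemma ordered_bell_widen n m : n < m ->
  ordered_bell n = \sum_(0 <= k < m) k`! * stirling2 n k.
Proof.
move=> nm; rewrite (big_cat_nat (n := n.+1)) //= [X in _ + X]big_nat_cond.
rewrite [X in _ + X]big1 ?addn0 // => k /andP[/andP[nk _] _].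
by rewrite stirling2_small ?muln0.
Qed.

Import GRing.Theory.
Local Open Scope ring_scope.

Lemma big_nat_parity (V : nmodType) (F : nat -> V) m :
  \sum_(0 <= k < 2 * m) F k =
  \sum_(0 <= k < m) F (2 * k)%N + \sum_(0 <= k < m) F (2 * k + 1)%N.
Proof.
elim: m => [|m IH]; first by rewrite muln0 !big_geq ?addr0.
by rewrite mulnS !addSn add0n !big_nat_recr //= IH addn1 -addrA addrACA.
Qed.

Lemma alternating_fact_stirling2 n m : (n < m)%N ->
  \sum_(0 <= k < m) (-1) ^+ k * (k`! * stirling2 n k)%N%:Z = (-1) ^+ n.
Proof.
elim: n m => [|n IH] [//|m] nm.
  rewrite big_nat_recl // stirling2_0 big1 ?addr0 // => k _.
  by rewrite stirling2_0 muln0 mulr0.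
pose b k : int := (-1) ^+ k * (k`! * stirling2 n k)%N%:Z.
rewrite big_nat_recl // stirling2S0 muln0 mulr0 add0r.
(* The recurrence gives [k.+1 * b k.+1 - k.+1 * b k]; splitting off one [b k] leaves a telescoping
   difference. Its boundary terms vanish because [n < m], and the sum of the [- b k] is known by
   induction. *)
rewrite (eq_bigr (fun k => (k.+1%:Z * b k.+1 - k%:Z * b k) - b k)) => [|k _].
  rewrite sumrB (telescope_sumr (fun k => k%:Z * b k)) // IH // mul0r subr0.
  by rewrite /b stirling2_small // muln0 !mulr0 sub0r exprS mulN1r.
rewrite factS -mulnA fact_stirling2SS /b exprS factS !PoszM !PoszD !PoszM.
rewrite intS; ring.
Qed.

Theorem theorem1 (n : nat) (hn : (1 <= n)%N) :
  ((ordered_bell n)%:Z =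
     (-1) ^+ (n + 1) +
     2 * \sum_(0 <= k < (n %/ 2).+1)
           ((2 * k)`! * stirling2 n (2 * k))%N%:Z
   /\
   (ordered_bell n)%:Z =
     (-1) ^+ n +
     2 * \sum_(0 <= k < (n %/ 2).+1)
           ((2 * k + 1)`! * stirling2 n (2 * k + 1))%N%:Z)
  /\
  (ordered_bell n =
     (\sum_(1 <= k < ((n + 1) %/ 2).+1)
        (2 * k - 1)`! * stirling2 (n + 1) (2 * k))%N
   /\
   ordered_bell n =
     (\sum_(0 <= k < ((n + 1) %/ 2).+1)
        (2 * k)`! * stirling2 (n + 1) (2 * k + 1))%N).
Proof.
have nlt : (n < 2 * (n %/ 2).+1)%N by rewrite mulnC ltn_ceil.
have Elt : (n < 2 * ((n + 1) %/ 2).+1)%N.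
  by rewrite mulnC (leq_trans _ (ltn_ceil _ _)) // addn1 ltnW.
have Alt := alternating_fact_stirling2 nlt.
have Bell : (ordered_bell n)%:Z =
    \sum_(0 <= k < (n %/ 2).+1) ((2 * k)`! * stirling2 n (2 * k))%N%:Z +
    \sum_(0 <= k < (n %/ 2).+1) ((2 * k + 1)`! * stirling2 n (2 * k + 1))%N%:Z.
  by rewrite (ordered_bell_widen nlt) big_nat_parity PoszD
    !(big_morph Posz PoszD (erefl 0)).
rewrite big_nat_parity in Alt.
rewrite (eq_bigr (fun k => ((2 * k)`! * stirling2 n (2 * k))%N%:Z)) in Alt;
  last by move=> k _; rewrite exprM sqrrN !expr1n mul1r.
rewrite [X in _ + X](eq_bigr
  (fun k => - ((2 * k + 1)`! * stirling2 n (2 * k + 1))%N%:Z)) in Alt;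
  last by move=> k _; rewrite exprD exprM sqrrN !expr1n mul1r mulN1r.
rewrite sumrN in Alt.
(* With E and O the even and odd sums, [Bell] reads B = E + O and [Alt] reads (-1)^n = E - O, so
   both formulas are linear identities in E and O. *)
split; first by rewrite exprD -Alt Bell; split; ring.
split.
  (* The bound is odd here: once the vanishing term at 0 is dropped, an even number of indices
     remains, paired as [2k+1] and [2k+2]. *)
  have mlt : (n < (2 * ((n + 1) %/ 2)).+1)%N.
    by rewrite ltnS -ltnS -[n.+1]addn1 mulnC; lia.
  have Sn0 : stirling2 n 0 = 0%N by case: (n) hn => // n' _; exact: stirling2S0.
  rewrite (ordered_bell_widen mlt) big_nat_recl // Sn0 muln0 add0n.
  rewrite big_nat_parity.
  rewrite big_add1 -big_split /=; apply: eq_bigr => k _.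
  by rewrite mulnS add2n subn1 !addn1 /= fact_stirling2SS addnC.
(* Here the indices are paired as [2k] and [2k+1], starting from 0. *)
rewrite (ordered_bell_widen Elt) big_nat_parity -big_split /=.
apply: eq_bigr => k _.
by rewrite !addn1 fact_stirling2SS addnC.
Qed.
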